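(* Let $\mathbf{R}$ be a real closed field and let $P, Q \in \mathbf{R}[X] \setminus \{0\}$ with $\deg P = p \ge 1$ and $\deg Q = q < p$. Let $s$, $d_i$, $t_i$, $\mathrm{p}(i)$ and $\epsilon_n$ be associated to $P$ and $Q$ as in the context. If the leading coefficient of $P$ is positive or if $d_0 - d_1 = p-q$ is even, then $$ \mathrm{Ind}_{\mathbf{R}}\Big( \frac{Q}{P} \Big) = \sum_{\substack{0 \le i \le s-1,\\ d_{i} - d_{i+1}\text{ odd}}} \epsilon_{d_{\mathrm{p}(i) - 1} - d_i}\cdot \mathrm{sign}(t_{\mathrm{p}(i)}) \cdot \mathrm{sign}(t_{i+1}). $$ If the leading coefficient of $P$ is negative and $d_0 - d_1 = p-q$ is odd, then $$ \mathrm{Ind}_{\mathbf{R}}\Big( \frac{Q}{P} \Big) = - \mathrm{sign}(t_{1}) + \sum_{\substack{1 \le i \le s-1,\\ d_{i} - d_{i+1}\text{ odd}}} \epsilon_{d_{\mathrm{p}(i) - 1} - d_i}\cdot \mathrm{sign}(t_{\mathrm{p}(i)}) \cdot \mathrm{sign}(t_{i+1}). $$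
   Context: $\mathbf{R}$ is a real closed field; $\mathrm{sign}(y)\in\{-1,0,1\}$ is the sign of $y \in \mathbf{R}$. **Cauchy index.** Let $x\in\mathbf{R}$ and $F,G\in\mathbf{R}[X]\setminus\{0\}$. Write uniquely $\frac{G}{F} = (X-x)^m \frac{\widetilde G}{\widetilde F}$ with $m\in\mathbb{Z}$, $\widetilde F$ monic, $\widetilde F,\widetilde G \in \mathbf{R}[X]$ coprime, $\widetilde F(x)\neq 0$, $\widetilde G(x)\ne 0$. If $m<0$, set $\mathrm{Ind}_x^+(\frac GF)=\frac12\mathrm{sign}\big(\frac{\widetilde G(x)}{\widetilde F(x)}\big)$ and $\mathrm{Ind}_x^-(\frac GF)=\frac12(-1)^m\mathrm{sign}\big(\frac{\widetilde G(x)}{\widetilde F(x)}\big)$; if $m\ge 0$, both are $0$. Set $\mathrm{Ind}_x(\frac GF)=\mathrm{Ind}_x^+(\frac GF)-\mathrm{Ind}_x^-(\frac GF)$. The Cauchy index on $\mathbf{R}$ is $\mathrm{Ind}_{\mathbf{R}}(\frac GF)=\sum_{x\in\mathbf{R}}\mathrm{Ind}_x(\frac GF)$ (only the finitely many roots of $F$ in $\mathbf{R}$ contribute). **Sturm sequence.** For $P,Q\in\mathbf{R}[X]\setminus\{0\}$: $S_0=P$, $S_1=Q$, $S_{i+1}=-\mathrm{Rem}(S_{i-1},S_i)$ (remainder of the Euclidean division of $S_{i-1}$ by $S_i$), and $s$ is the index such that $S_1,\dots,S_s\neq0$ and $S_{s+1}=0$. Let $d_i=\deg S_i$ for $0\le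 i\le s$ and $d_{-1}=p+1$ (so $d_0=p$, $d_1=q$). **Subresultants.** Let $\deg P=p\ge1$, $\deg Q=q<p$. For $0\le j\le q$, $\mathrm{sResP}_j(P,Q)\in\mathbf{R}[X]$ is the determinant of the $(p+q-2j)\times(p+q-2j)$ matrix whose rows correspond, from top to bottom, to the polynomials $X^{q-j-1}P,\dots,XP,P,Q,XQ,\dots,X^{p-j-1}Q$ (in this order); in each row the first $p+q-2j-1$ entries are the coefficients of $X^{p+q-j-1},X^{p+q-j-2},\dots,X^{j+1}$ in the corresponding polynomial, and the last entry is the polynomial itself. By convention $\mathrm{sResP}_p(P,Q)=P$, $\mathrm{sResP}_{p-1}(P,Q)=Q$, and $\mathrm{sResP}_j(P,Q)=0$ for $q<j<p-1$. Set $T_0=P$, $t_0=1$ (even if $P$ is not monic), and for $1\le i\le s$, $T_i=\mathrm{sResP}_{d_{i-1}-1}(P,Q)$ and $t_i=$ the leading coefficient of $T_i$. (So $T_1=Q$; by the known Structure Theorem of Subresultants, each $T_i$ is nonzero of degree $d_i$.) **Further notation.** For $n\in\mathbb{Z}$, $\epsilon_n=(-1)^{\frac12 n(n-1)}$. For $0\le i\le s$, $\mathrm{p}(i)=\max\{j \mid 0\le j\le i,\ d_{j-1}-d_j \text{ is odd}\}$ (well defined since $d_{-1}-d_0=1$). *)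

(* Defs.v *)
From HB Require Import structures.
From mathcomp Require Import all_boot all_order all_algebra.
From mathcomp Require Import polyorder polyrcf.

Set Implicit Arguments.
Unset Strict Implicit.
Unset Printing Implicit Defensive.

Import Order.TTheory GRing.Theory Num.Theory.
Local Open Scope ring_scope.

Section CauchyIndex.
Variable R : rcfType.
Implicit Types (F G : {poly R}) (x : R).

(* The decomposition G / F = (X - x)^m * (Gt / Ft) with Gt and Ft coprime,
   nonvanishing at x, and Ft monic.  The three components are computed below;
   [local_decompP] and [local_decomp_unique] show that, for nonzero F and G,
   they form the only decomposition of this shape. *)
Definition local_decomp x F G (m : int) (Ft Gt : {poly R}) : Prop :=
  [/\ Ft \is monic, coprimep Ft Gt, Ft.[x] != 0, Gt.[x] != 0 &
      tofrac G / tofrac F = tofrac ('X - x%:P) ^ m * (tofrac Gt / tofrac Ft)].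

Definition local_order x F G : int := (\mu_x G)%:Z - (\mu_x F)%:Z.

Definition strip_root x F : {poly R} := F %/ ('X - x%:P) ^+ \mu_x F.

Definition local_lead x F G : R :=
  lead_coef (strip_root x (F %/ gcdp F G)).

Definition local_den x F G : {poly R} :=
  (local_lead x F G)^-1 *: strip_root x (F %/ gcdp F G).

Definition local_num x F G : {poly R} :=
  (local_lead x F G)^-1 *: strip_root x (G %/ gcdp F G).

Lemma strip_rootK x F : F = strip_root x F * ('X - x%:P) ^+ \mu_x F.
Proof. by rewrite divpK // root_mu. Qed.

Lemma strip_root_dvd x F : strip_root x F %| F.
Proof. by rewrite {2}(strip_rootK x F) dvdp_mulr. Qed.

Lemma strip_root_neq0 x F : F != 0 -> strip_root x F != 0.
Proof. by apply: contraNneq => F0; rewrite (strip_rootK x F) F0 mul0r. Qed.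

Lemma strip_root_horner x F : F != 0 -> (strip_root x F).[x] != 0.
Proof.
move=> F_neq0; apply/negP => /eqP /eqP; rewrite -/(root _ _) => /factor_theorem.
case=> q Eq; have := strip_rootK x F; rewrite Eq -mulrA -exprS => EF.
have : ('X - x%:P) ^+ (\mu_x F).+1 %| F by rewrite {2}EF dvdp_mull.
by rewrite root_le_mu // ltnn.
Qed.

Lemma local_decompP x F G : F != 0 -> G != 0 ->
  local_decomp x F G (local_order x F G) (local_den x F G) (local_num x F G).
Proof.
move=> F0 G0; set D := gcdp F G.
have D0 : D != 0 by rewrite gcdp_eq0 negb_and F0.
have EF : F = F %/ D * D by rewrite divpK // dvdp_gcdl.
have EG : G = G %/ D * D by rewrite divpK // dvdp_gcdr.
have F10 : F %/ D != 0 by apply: contraNneq F0 => E; rewrite EF E mul0r.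
have G10 : G %/ D != 0 by apply: contraNneq G0 => E; rewrite EG E mul0r.
have cFG : coprimep (F %/ D) (G %/ D).
  by rewrite coprimep_div_gcd // F0.
have l0 : local_lead x F G != 0 by rewrite lead_coef_eq0 strip_root_neq0.
have li0 : (local_lead x F G)^-1 != 0 by rewrite invr_eq0.
split.
- by rewrite monicE lead_coefZ mulVf.
- rewrite coprimepZl // coprimepZr //.
  exact: coprimep_dvdl (strip_root_dvd _ _)
    (coprimep_dvdr (strip_root_dvd _ _) cFG).
- by rewrite hornerZ mulf_neq0 // strip_root_horner.
- by rewrite hornerZ mulf_neq0 // strip_root_horner.
have X0 : tofrac ('X - x%:P) != 0 by rewrite tofrac_eq0 polyXsubC_eq0.
have nzt p : p != 0 -> tofrac p != 0 by rewrite tofrac_eq0.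
have -> : local_order x F G
    = (\mu_x (G %/ D))%:Z - (\mu_x (F %/ D))%:Z.
  rewrite /local_order {1}EG {1}EF !mu_mul ?mulf_neq0 //.
  by rewrite !PoszD opprD addrACA subrr addr0.
rewrite {1}EF {1}EG !tofracM -mulf_div divff ?nzt // mulr1.
rewrite {1}(strip_rootK x (F %/ D)) {1}(strip_rootK x (G %/ D)).
rewrite /local_num /local_den -!mul_polyC !tofracM !tofracXn.
rewrite -!mulf_div divff ?nzt ?polyC_eq0 // mul1r mulrC.
by congr (_ * _); rewrite expfzDr // -exprnN.
Qed.

Lemma frac_cross (K : fieldType) (z a b a' b' : K) (m : int) (k : nat) :
  z != 0 -> b != 0 -> b' != 0 ->
  z ^ m * (a / b) = z ^ (m + k%:Z) * (a' / b') -> a * b' = z ^+ k * a' * b.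
Proof.
move=> z0 b0 b0'; rewrite expfzDr // -mulrA => /(mulfI (expfz_neq0 m z0)) E.
by apply/eqP; rewrite -eqr_div // E -exprnP mulrA.
Qed.

Lemma local_decomp_unique x F G m Ft Gt m' Ft' Gt' :
  local_decomp x F G m Ft Gt -> local_decomp x F G m' Ft' Gt' ->
  [/\ m = m', Ft = Ft' & Gt = Gt'].
Proof.
wlog le_mm' : m Ft Gt m' Ft' Gt' / m <= m'.
  move=> W d d'; have [/W|/ltW /W] := leP m m'; first exact.
  by case/(_ _ _ _ _ d' d) => -> -> ->.
case=> mF cF Fx Gx E [mF' cF' Fx' Gx'].
have X0 : tofrac ('X - x%:P) != 0 by rewrite tofrac_eq0 polyXsubC_eq0.
have t0 : tofrac Ft != 0 by rewrite tofrac_eq0 monic_neq0.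
have t0' : tofrac Ft' != 0 by rewrite tofrac_eq0 monic_neq0.
have [k Ek] : exists k : nat, m' = m + k%:Z.
  exists `|m' - m|%N; rewrite gez0_abs ?subr_ge0 //.
  by rewrite [RHS]addrC subrK.
rewrite E Ek => /(frac_cross X0 t0 t0') /eqP.
rewrite -tofracXn -!tofracM tofrac_eq => /eqP E2.
have k0 : k = 0%N.
  case: (posnP k) => // k_gt0; have /negP[] : (Gt * Ft').[x] != 0.
    by rewrite hornerM mulf_neq0.
  by rewrite E2 !hornerM horner_exp hornerXsubC subrr expr0n eqn0Ngt k_gt0 !mul0r.
move: E2; rewrite k0 expr0 mul1r => E2.
have EF : Ft = Ft'.
  apply/eqP; rewrite -eqp_monic //; apply/andP; split.
    by rewrite -(Gauss_dvdpr _ cF) E2 dvdp_mull.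
  by rewrite -(Gauss_dvdpr _ cF') -E2 dvdp_mull.
split=> //; first by rewrite addr0.
by move: E2; rewrite EF; apply/mulIf/monic_neq0.
Qed.

Definition Ind_plus x F G : R :=
  if local_order x F G < 0 then
    2^-1 * Num.sg ((local_num x F G).[x] / (local_den x F G).[x])
  else 0.

Definition Ind_minus x F G : R :=
  if local_order x F G < 0 then
    2^-1 * (-1) ^ (local_order x F G) *
      Num.sg ((local_num x F G).[x] / (local_den x F G).[x])
  else 0.

(* Index of G / F at x; note the order of the arguments F and G. *)
Definition Ind_at x F G : R := Ind_plus x F G - Ind_minus x F G.

Lemma Ind_at_nonroot x F G : ~~ root F x -> Ind_at x F G = 0.
Proof.
move=> Fx; have le0 : (local_order x F G < 0) = false.
  by rewrite /local_order (muNroot Fx) subr0.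
by rewrite /Ind_at /Ind_plus /Ind_minus le0 subr0.
Qed.

(* By [Ind_at_nonroot], summing over the roots of F is summing over R. *)
Definition Ind_R F G : R := \sum_(x <- rootsR F) Ind_at x F G.

End CauchyIndex.

Section Sturm.
Variable R : rcfType.
Implicit Types (P Q : {poly R}).

Definition deg P : nat := (size P).-1.

(* (S_i, S_{i+1}) *)
Fixpoint sturm_pair P Q (i : nat) : {poly R} * {poly R} :=
  if i is k.+1 then
    let: (A, B) := sturm_pair P Q k in (B, - (A %% B))
  else (P, Q).

Definition sturm P Q (i : nat) : {poly R} := (sturm_pair P Q i).1.

Lemma sturm0 P Q : sturm P Q 0 = P. Proof. by []. Qed.

Lemma sturm1 P Q : sturm P Q 1 = Q. Proof. by []. Qed.

Lemma sturmSS P Q i :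
  sturm P Q i.+2 = - (sturm P Q i %% sturm P Q i.+1).
Proof. by rewrite /sturm /=; case: (sturm_pair P Q i). Qed.

Lemma sturm_terminates P Q : exists n, sturm P Q n.+1 == 0.
Proof.
suff H k : (exists n, sturm P Q n.+1 == 0) \/ (size (sturm P Q k.+1) + k <= size Q)%N.
  have [//|] := H (size Q).+1.
  by rewrite addnS ltnNge leq_addl.
elim: k => [|k [IH|IH]]; [by right; rewrite addn0 | by left|].
have [E|n0] := eqVneq (sturm P Q k.+1) 0; first by left; exists k; rewrite E.
right; apply: leq_trans IH; rewrite sturmSS size_polyN addnS -addSn leq_add2r.
by rewrite ltn_modp.
Qed.

(* The index s: S_{s+1} = 0 and S_1, ..., S_s are nonzero. *)
Definition sturm_len P Q : nat := ex_minn (sturm_terminates P Q).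

Definition sdeg P Q (i : nat) : nat := deg (sturm P Q i).

(* d_{i-1}, where d_{-1} = p + 1 *)
Definition sdeg_pred P Q (i : nat) : nat :=
  if i is k.+1 then sdeg P Q k else (deg P).+1.

(* p(i); the case j = 0 always satisfies the condition.  The natural number
   subtraction is exact, as the d_j are strictly decreasing for j <= s. *)
Definition last_odd P Q (i : nat) : nat :=
  \max_(j < i.+1 | odd (sdeg_pred P Q j - sdeg P Q j)) j.

End Sturm.

Section Subresultants.
Variable R : rcfType.
Implicit Types (P Q : {poly R}).

(* The polynomial of row r of the j-th subresultant matrix: X^{q-j-1} P, ...,
   X P, P, Q, X Q, ..., X^{p-j-1} Q, from top to bottom. *)
Definition sRes_row P Q (j r : nat) : {poly R} :=
  if (r < deg Q - j)%N then 'X^(deg Q - j - 1 - r) * P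
  else 'X^(r - (deg Q - j)) * Q.

(* Column c < p + q - 2j - 1 holds the coefficients of X^{p+q-j-1-c}. *)
Definition sRes_mx P Q (j : nat) :
    'M[{poly R}]_(deg P + deg Q - 2 * j) :=
  \matrix_(r, c)
    if c.+1 == (deg P + deg Q - 2 * j)%N then sRes_row P Q j r
    else ((sRes_row P Q j r)`_(deg P + deg Q - j - 1 - c))%:P.

(* The value 0 is the convention for q < j < p - 1 (j > p is irrelevant). *)
Definition sResP P Q (j : nat) : {poly R} :=
  if (j <= deg Q)%N then \det (sRes_mx P Q j)
  else if j == deg P then P
  else if j == (deg P).-1 then Q
  else 0.

Definition sResT P Q (i : nat) : {poly R} :=
  if i is k.+1 then sResP P Q (sdeg P Q k).-1 else P.

(* t_0 = 1 even if P is not monic. *)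
Definition sRest P Q (i : nat) : R :=
  if i is 0 then 1 else lead_coef (sResT P Q i).

End Subresultants.

Definition eps (R : rcfType) (n : int) : R :=
  (-1) ^ ((n * (n - 1)) %/ 2)%Z.

(* Main.v *)
Require Import Defs.
From mathcomp Require Import all_boot all_order all_algebra.
From mathcomp Require Import polyorder polyrcf qe_rcf_th zify ring.
Import Order.TTheory GRing.Theory Num.Theory.
Local Open Scope ring_scope.

Set Implicit Arguments.
Unset Strict Implicit.
Unset Printing Implicit Defensive.

(** Write a_i for the sign of the leading coefficient of S_i, sigma_i for the
    sign of t_i, and delta_i = d_{i-1} - d_i.  The number eps_n is the sign
    (-1)^'C(n, 2) of the reversal of n rows.

    The Cauchy index satisfies an inversion formula: Ind(Q/P) + Ind(P/Q) is
    half the jump of the sign of P Q between -oo and +oo, which is a_0 a_1 if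
    p - q is odd and 0 otherwise; and Ind(P/Q) only depends on P modulo Q.
    Iterating it along the Sturm sequence gives Ind(Q/P) as the sum of the
    a_i a_{i+1} over the i such that delta_{i+1} is odd ([Ind_R_sturm]).  It
    remains to express a_i a_{i+1} through the sigma's.

    Row operations on the subresultant matrix replace P by P mod Q = - S_2;
    after that the last rows X^k Q have distinct leading columns and can be
    split off one by one, and the rows that are left are those of the matrix
    of (Q, S_2) in reverse order.  Hence, with b_i the leading coefficient of
    S_i ([sResP_next], [sResP_pred]),
      sResP_j(S_0, S_1) = eps_{delta_1} b_1^(d_0 - d_2) sResP_j(S_1, S_2)
    for j <= d_2, and
      sResP_{d_1 - 1}(S_0, S_1) = eps_{delta_1} b_1^(delta_1 + 1) S_2.
    Iterating, T_i is an explicit multiple of S_i, and in the quotient of two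
    consecutive t's all the earlier factors cancel ([sgr_sRest_rec]):
      sigma_{i+1} sigma_i
        = eps_{delta_i} a_{i-1}^(delta_i + 1) a_i^delta_i a_{i+1}   (i >= 2).
    For i = 1 the same holds with a_0 replaced by 1, because T_1 = S_1 and the
    factor of T_2 only involves b_1.

    If delta_i is odd this reads a_i = eps_{delta_i} sigma_i sigma_{i+1}
    a_{i+1}.  If delta_i is even, it transfers to i the corresponding formula
    for i - 1, because eps_{m + n} = eps_m eps_n when n is even; if moreover
    i = 1, it starts the chain from t_0 = 1, p(1) = 0 and d_{-1} - d_0 = 1.
    By induction, for i >= 1 ([lead_sturm_sign]),
      a_i = eps_{d_{p(i)-1} - d_i} sigma_{p(i)} sigma_{i+1} a_{i+1},
    which turns a_i a_{i+1} into the required term.  This also holds for i = 0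
    unless a_0 = -1; in that case the term i = 0 is absent if p - q is even, and
    equals a_0 a_1 = - sigma_1 if p - q is odd. *)

(** * The Cauchy index and Euclidean division *)

Lemma sgp_right_strip_root (R : rcfType) (x : R) (F : {poly R}) :
  F != 0 -> sgp_right F x = Num.sg (strip_root x F).[x].
Proof.
move=> F0; rewrite {1}(strip_rootK x F) sgp_right_mul.
rewrite (@sgp_rightNroot _ (strip_root x F)) ?strip_root_horner //.
suff -> : sgp_right (('X - x%:P) ^+ \mu_x F) x = 1 by rewrite mulr1.
elim: (\mu_x F) => [|n IH]; first by rewrite expr0 sgp_rightc sgr1.
rewrite exprS sgp_right_mul IH mulr1 sgp_right_rec polyXsubC_eq0 root_XsubC eqxx /=.
by rewrite derivXsubC sgp_rightc sgr1.
Qed.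

(** Dividing F and G by their gcd multiplies F G by a square, which does not
    affect its sign to the right of x. *)
Lemma Ind_at_jump (R : rcfType) (x : R) (F G : {poly R}) :
  F != 0 -> G != 0 -> Ind_at x F G = (jump G F x)%:~R.
Proof.
move=> F0 G0; rewrite /Ind_at /Ind_plus /Ind_minus /jump G0 /=.
have [le_mu|lt_mu] := leqP (\mu_x F) (\mu_x G).
  by rewrite /local_order subr_lt0 ltz_nat ltnNge le_mu /= subrr (eqP le_mu) mulr0n.
have Eord : local_order x F G = - (\mu_x F - \mu_x G)%N%:Z.
  by rewrite /local_order -subzn ?opprB // ltnW.
rewrite subr_lt0 ltz_nat lt_mu Eord.
have -> : (-1 : R) ^ (- (\mu_x F - \mu_x G)%N%:Z) = (-1) ^+ odd (\mu_x F - \mu_x G).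
  by rewrite -exprnN signr_odd -exprVn invrN1.
have -> : Num.sg ((local_num x F G).[x] / (local_den x F G).[x])
        = sgp_right (G * F) x.
  set D := gcdp F G.
  have D0 : D != 0 by rewrite gcdp_eq0 negb_and F0.
  have EF : F = F %/ D * D by rewrite divpK // dvdp_gcdl.
  have EG : G = G %/ D * D by rewrite divpK // dvdp_gcdr.
  have F10 : F %/ D != 0 by apply: contraNneq F0 => E; rewrite EF E mul0r.
  have G10 : G %/ D != 0 by apply: contraNneq G0 => E; rewrite EG E mul0r.
  have l0 : (local_lead x F G)^-1 != 0.
    by rewrite invr_eq0 lead_coef_eq0 strip_root_neq0.
  rewrite /local_num /local_den !hornerZ -mulf_div divff // mul1r.
  rewrite sgrM sgrV -!sgp_right_strip_root //.
  have -> : sgp_right (G * F) x = sgp_right (G %/ D * D * (F %/ D * D)) x.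
    by rewrite -EF -EG.
  by rewrite !sgp_right_mul mulrACA sgp_right_square ?mulr1.
have : sgp_right (G * F) x != 0 by rewrite sgp_right_eq0 mulf_neq0.
have : sgp_right (G * F) x = Num.sg (sgp_right (G * F) x).
  by rewrite sgp_right_mul !sgp_right_strip_root // sgrM !sgr_id.
move: (sgp_right _ _) => u Eu u0.
rewrite {1 2}Eu (sgr_def u) u0 mulr1n.
case: odd; rewrite ?expr0 ?expr1 ?mulr1n ?mulr0n; last by rewrite mulr1 subrr.
by rewrite mulrN1 mulNr opprK -mulrDl -div1r -splitr mul1r; case: (u < 0).
Qed.

Lemma Ind_R_cindexR (R : rcfType) (F G : {poly R}) :
  F != 0 -> G != 0 -> Ind_R F G = (cindexR G F)%:~R.
Proof.
move=> F0 G0; rewrite /Ind_R /cindexR rmorph_sum /=.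
by apply: eq_bigr => x _; apply: Ind_at_jump.
Qed.

(** P Q changes sign between -oo and +oo exactly when its degree is odd. *)
Lemma crossR_mul (R : rcfType) (P Q : {poly R}) :
  P != 0 -> Q != 0 ->
  (crossR (P * Q))%:~R =
    (Num.sg (lead_coef P) * Num.sg (lead_coef Q)) *+ odd (deg P + deg Q) :> R.
Proof.
move=> P0 Q0; rewrite /crossR /variation /sgp_minfty /sgp_pinfty.
have -> : (size (P * Q)).-1 = (deg P + deg Q)%N.
  rewrite size_mul // /deg.
  by move: P0 Q0; rewrite -!size_poly_gt0; do 2!case: size => // ? _; rewrite !addnS addSn.
have -> : Num.sg (lead_coef P) * Num.sg (lead_coef Q)
        = Num.sg (lead_coef (P * Q)) by rewrite lead_coefM sgrM.
rewrite intrM -sgrEz sgr_id -signr_odd.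
have := mulf_neq0 P0 Q0; rewrite -lead_coef_eq0; move: (lead_coef _) => c c0.
case: odd; rewrite ?expr0 ?expr1 ?mul1r ?mulN1r ?sgrN ?mulNr -?sgrM -expr2.
  by rewrite sgrX sqr_sg c0 oppr_lt0 ltr01 mulr1n mulr1.
by rewrite sgrX sqr_sg c0 ltr10 mulr0.
Qed.

(** [next_mod] comes from pseudo-division: it is the opposite of
    the Euclidean remainder up to a square factor, which leaves the index
    unchanged. *)
Lemma cindexR_mod (R : rcfType) (P Q : {poly R}) :
  cindexR Q P = crossR (P * Q) + cindexR (- (P %% Q)) Q.
Proof.
rewrite cindexR_rec; congr (_ + _).
have [->|Q0] := eqVneq Q 0; first by rewrite /cindexR rootsR0 !big_nil.
have c0 : lead_coef Q ^+ Pdiv.CommonRing.rscalp P Q != 0 by rewrite expf_neq0 ?lead_coef_eq0.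
have -> : next_mod P Q = (lead_coef Q ^+ Pdiv.CommonRing.rscalp P Q) ^+ 2 *: - (P %% Q).
  rewrite /next_mod Pdiv.WeakIdomain.modpE unitfE lead_coef_eq0 Q0.
  by rewrite scalerN scalerA expr2 mulfK // scaleNr.
rewrite /cindexR; apply: eq_bigr => x _.
rewrite jump_mulCp sgzX.
by case: sgzP c0 => // _ _; rewrite ?sqrrN expr1n mul1r.
Qed.

(** * Determinants of families of polynomials *)

(** Turned into signs: eps_{a + b} = eps_a eps_b (-1)^(a b). *)
Lemma bin2D a b : 'C(a + b, 2) = ('C(a, 2) + 'C(b, 2) + a * b)%N.
Proof.
elim: a => [|a IH]; first by rewrite !add0n mul0n addn0.
by rewrite addSn !binS !bin1 IH mulSn; lia.
Qed.

Lemma odd_bin2_double k : odd 'C(k.*2, 2) = odd k.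
Proof. by rewrite -addnn bin2D addnn oddD odd_double oddM andbb. Qed.

Section RowDeterminants.
Variable R : comNzRingType.
Implicit Types (f g : nat -> {poly R}) (P Q U : {poly R}).

(** The subresultant determinant of an arbitrary family of n rows: X^(n + j - 1)
    is the highest monomial that has a column.  With f a function on nat, rows
    can be dropped or permuted without changing the type. *)
Definition rows_det (n j : nat) f : {poly R} :=
  \det (\matrix_(r < n, c < n)
    if c.+1 == n then f r else ((f r)`_(n + j - 1 - c))%:P).

Lemma eq_rows_det n j f g :
  (forall r, (r < n)%N -> f r = g r) -> rows_det n j f = rows_det n j g.
Proof. by move=> E; congr (\det _); apply/matrixP => r c; rewrite !mxE E. Qed.

(** The entries of a row are R-linear functions of its polynomial, so every
    row operation amounts to a product with a scalar matrix. *)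
Lemma rows_det_mul n j (L : 'M[R]_n) f g :
  (forall r : 'I_n, f r = \sum_c L r c *: g c) ->
  rows_det n j f = (\det L)%:P * rows_det n j g.
Proof.
move=> E; rewrite /rows_det -det_map_mx -det_mulmx; congr (\det _).
apply/matrixP => r c; rewrite !mxE E.
under [RHS]eq_bigr => k _ do rewrite !mxE.
case: (c.+1 == n); first by apply: eq_bigr => k _; rewrite mul_polyC.
by rewrite coef_sum rmorph_sum /=; apply: eq_bigr => k _; rewrite coefZ polyCM.
Qed.

Lemma rows_det1 j f : rows_det 1 j f = f 0.
Proof. by rewrite /rows_det det_mx11 mxE. Qed.

(** If only the last row involves the highest monomial, expanding along the
    first column splits off that row. *)
Lemma rows_det_top n j f :
  (forall r, (r < n.+1)%N -> (f r)`_(n.+1 + j) = 0) ->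
  rows_det n.+2 j f =
    ((-1) ^+ n.+1 * (f n.+1)`_(n.+1 + j))%:P * rows_det n.+1 j f.
Proof.
move=> f0; rewrite /rows_det (expand_det_col _ ord0) (bigD1 ord_max) //= big1.
  rewrite addr0 [X in X * _]mxE /= subn0 addSn subn1 /= /cofactor addn0.
  rewrite mulrCA mulrA polyCM rmorphXn rmorphN1; congr (_ * _ * \det _).
  apply/matrixP => r c; rewrite !mxE lift0 lift_max eqSS.
  by case: eqP => // _; congr (_`__)%:P; lia.
move=> r; rewrite -val_eqE /= => r_max.
by rewrite !mxE /= subn0 !addSn subn1 /= -addSn f0 ?mul0r //; have := ltn_ord r; lia.
Qed.

Lemma det_antidiag n :
  \det (\matrix_(r < n, c < n) ((r + c)%N == n.-1)%:R) = (-1) ^+ 'C(n, 2) :> R.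
Proof.
elim: n => [|n IH]; first by rewrite det_mx00.
rewrite (expand_det_col _ ord0) (bigD1 ord_max) //= big1 => [|r].
  rewrite addr0 !mxE /= addn0 eqxx mul1r /cofactor addn0 binS bin1 addnC exprD -IH.
  congr (_ * \det _); apply/matrixP => r c; rewrite !mxE; congr (_%:R).
  by rewrite lift0 lift_max; have := ltn_ord r; lia.
rewrite -val_eqE /= => r_max.
by rewrite !mxE addn0 (negPf r_max) mul0r.
Qed.

Lemma rows_det_rev n j f :
  rows_det n j (fun r => f (n.-1 - r)%N) = ((-1) ^+ 'C(n, 2))%:P * rows_det n j f.
Proof.
rewrite -det_antidiag; apply: rows_det_mul => r.
have r' : (n.-1 - r < n)%N by have := ltn_ord r; lia.
rewrite (bigD1 (Ordinal r')) //= big1 ?addr0 => [|c].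
  by rewrite mxE /= subnKC ?eqxx ?scale1r //; have := ltn_ord r; lia.
rewrite -val_eqE /= mxE => c_neq; case: eqP => [E|]; last by rewrite scale0r.
by have := ltn_ord r; lia.
Qed.

(** The rows n < r <= n + e form a staircase, so [rows_det_top] removes them
    from the bottom up; the signs (-1)^(n + k) it produces and the sign of the
    reversal of the remaining n + 1 rows add up to the sign of the reversal of
    all n + 1 + e rows. *)
Lemma rows_det_elim n e j b f :
  (forall r, (r <= n)%N -> (size (f r) <= n.+1 + j)%N) ->
  (forall r, (n < r <= n + e)%N -> size (f r) = (r + j).+1 /\ lead_coef (f r) = b) ->
  rows_det (n.+1 + e) j f =
    ((-1) ^+ 'C(n.+1 + e, 2) * b ^+ e)%:P * rows_det n.+1 j (fun r => f (n - r)%N).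
Proof.
move=> f_low f_top.
suff -> : rows_det (n.+1 + e) j f =
   ((-1) ^+ ('C(n.+1 + e, 2) + 'C(n.+1, 2)) * b ^+ e)%:P * rows_det n.+1 j f.
  rewrite -[fun r => f (n - r)%N]/(fun r => f (n.+1.-1 - r)%N) rows_det_rev.
  by rewrite mulrA -polyCM mulrAC -exprD.
elim: e f_top => [|e IH] f_top.
  by rewrite addn0 addnn -signr_odd odd_double !mul1r.
have f0 r : (r < (n + e).+1)%N -> (f r)`_((n + e).+1 + j) = 0.
  move=> r_lt; apply: nth_default.
  have [r_le|r_gt] := leqP r n; first by apply: leq_trans (f_low r r_le) _; lia.
  by have [-> _] := f_top r ltac:(lia); lia.
rewrite addnS (@rows_det_top (n + e) j f f0) -[(n + e).+1]/(n.+1 + e)%N.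
rewrite IH; last by move=> r r_lt; apply: f_top; lia.
have [Es El] := f_top (n + e.+1)%N ltac:(lia).
have -> : (f (n.+1 + e)%N)`_(n.+1 + e + j) = b.
  by rewrite -El lead_coefE Es /= addnS.
rewrite mulrA -polyCM; congr (_%:P * _).
rewrite mulrACA -exprD exprSr; congr (_ ^+ _ * _); last by rewrite mulrC.
by rewrite [in RHS]binS bin1 addnA [in LHS](addnC (n.+1 + e)%N).
Qed.

(** [sRes_row] with the number a of rows X^k P as a parameter; for
    [sResP P Q j], a = q - j. *)
Definition block_rows P Q (a r : nat) : {poly R} :=
  if (r < a)%N then 'X^(a - 1 - r) * P else 'X^(r - a) * Q.

(** X^k P = X^k U Q - X^k S, and X^k U Q is a combination of the rows X^i Q
    with i < m by the bound on U; the matrix of the row operation is triangular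
    with diagonal entries -1 (a times) and 1 (m times). *)
Lemma rows_det_reduce a m j P Q S U :
  P = U * Q - S -> (a - 1 + size U <= m)%N ->
  rows_det (a + m) j (block_rows P Q a) =
    ((-1) ^+ a)%:P * rows_det (a + m) j (block_rows S Q a).
Proof.
move=> EP szU.
pose L : 'M[R]_(a + m) := \matrix_(r, c)
  ((if (r < a)%N then -1 else 1) *+ (r == c)
   + (if (r < a)%N && (a <= c)%N then ('X^(a - 1 - r) * U)`_(c - a) else 0)).
have -> : (-1) ^+ a = \det L.
  rewrite -det_tr det_trig.
    rewrite big_split_ord /= [X in X * _](eq_bigr (fun=> -1)); last first.
      by move=> i _; rewrite !mxE eqxx /= ltn_ord leqNgt ltn_ord addr0.
    rewrite prodr_const card_ord big1 ?mulr1 // => i _.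
    by rewrite !mxE eqxx /= ltnNge leq_addr addr0.
  apply/is_trig_mxP => i k lt_ik; rewrite !mxE.
  rewrite -val_eqE /= gtn_eqF // mulr0n add0r.
  by case: ifP => // /andP[lt_ka le_ai]; lia.
apply: rows_det_mul => r.
under eq_bigr => c _ do rewrite mxE scalerDl.
rewrite big_split /= (bigD1 r) //= eqxx mulr1n big1 ?addr0 => [|c]; last first.
  by rewrite eq_sym => /negPf ->; rewrite mulr0n scale0r.
rewrite /block_rows; case: ifP => r_lt; last first.
  by rewrite big1 ?addr0 ?scale1r // => c _; rewrite scale0r.
rewrite big_split_ord /= big1 ?add0r => [|c _]; last first.
  by rewrite leqNgt ltn_ord scale0r.
under eq_bigr => c _ do rewrite leq_addr /= ltnNge leq_addr /= addKn scalerAl.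
rewrite -mulr_suml -poly_def.
have -> : \poly_(i < m) ('X^(a - 1 - r) * U)`_i = 'X^(a - 1 - r) * U.
  apply: take_poly_id; apply: leq_trans (size_polyMleq _ _) _.
  by rewrite size_polyXn; lia.
by rewrite EP mulrBr mulrA scaleN1r addrC.
Qed.

End RowDeterminants.

(** * Signs *)

Lemma sgr_sqr1 (R : realDomainType) (x : R) : x != 0 -> Num.sg x * Num.sg x = 1.
Proof. by move=> x0; rewrite -expr2 sqr_sg x0. Qed.

Lemma sign_sqr1 (R : pzRingType) n : (-1) ^+ n * (-1) ^+ n = 1 :> R.
Proof. by rewrite -expr2 sqrr_sign. Qed.

Lemma sqr1_exprE (R : pzRingType) (x : R) n :
  x * x = 1 -> x ^+ n = if odd n then x else 1.
Proof.
move=> xx; rewrite -{1}[n]odd_double_half exprD -ssrnat.mul2n exprM expr2 xx expr1n mulr1.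
by case: odd.
Qed.

Lemma eps_nat (R : rcfType) n : eps R n%:Z = (-1) ^+ 'C(n, 2).
Proof.
case: n => [|n] //; rewrite /eps bin2.
have -> : (n.+1%:Z * (n.+1%:Z - 1) = (n.+1 * n)%N%:Z)%R by rewrite PoszM; lia.
by rewrite divz_nat divn2.
Qed.

(** * One step of the Euclidean algorithm on subresultants *)

Section SubresultantStep.
Variable R : rcfType.
Implicit Types P Q S : {poly R}.

Lemma sResP_rows P Q j : (j <= deg Q)%N -> (deg Q < deg P)%N ->
  sResP P Q j = rows_det (deg P + deg Q - 2 * j) j (block_rows P Q (deg Q - j)).
Proof.
move=> j_le q_lt; rewrite /sResP j_le; congr (\det _); apply/matrixP => r c.
rewrite !mxE; case: eqP => // _; congr (_`__)%:P.
by have := ltn_ord c; lia.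
Qed.

(** The factor (-1)^(q - j) comes from replacing the q - j rows -X^k S by X^k S,
    where S = - (P mod Q).  The total sign does not depend on j, which makes the
    step from (P, Q) to (Q, S) uniform in j. *)
Lemma sign_reversal p q j : (j <= q)%N -> (q <= p)%N ->
  (-1) ^+ (q - j) * (-1) ^+ 'C(p + q - 2 * j, 2) = (-1) ^+ 'C(p - q, 2) :> R.
Proof.
move=> j_le q_le.
have -> : (p + q - 2 * j = (p - q) + (q - j).*2)%N by lia.
rewrite -exprD -signr_odd -[RHS]signr_odd bin2D !oddD odd_bin2_double oddM.
by rewrite odd_double andbF addbF addbC addbK.
Qed.

(** The common part of [sResP_pred] and [sResP_next]: replace P by minus
    its remainder, then remove the last e rows.  The reversal of the remaining
    rows is recorded in the index n - r. *)
Lemma sResP_elim P Q j n e : Q != 0 ->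
  (j < deg Q)%N -> (deg Q < deg P)%N ->
  (n.+1 + e = deg P + deg Q - 2 * j)%N ->
  (size (P %% Q)%R + e <= (deg P).+1)%N -> (e <= deg P - j)%N ->
  sResP P Q j =
    ((-1) ^+ 'C(deg P - deg Q, 2) * lead_coef Q ^+ e)%:P *
    rows_det n.+1 j (fun r => block_rows (- (P %% Q)) Q (deg Q - j) (n - r)%N).
Proof.
move=> Q0 j_lt q_lt En sz_mod e_le.
have szQ : size Q = (deg Q).+1 by rewrite prednK ?size_poly_gt0.
have P0 : P != 0 by apply: contraTneq q_lt => ->; rewrite /deg size_poly0.
have szP : size P = (deg P).+1 by rewrite prednK ?size_poly_gt0.
rewrite sResP_rows ?(ltnW j_lt) //.
have -> : (deg P + deg Q - 2 * j = (deg Q - j) + (deg P - j))%N by lia.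
rewrite (@rows_det_reduce _ _ _ _ P Q (- (P %% Q)) (P %/ Q)).
- have -> : ((deg Q - j) + (deg P - j) = n.+1 + e)%N by lia.
  rewrite (@rows_det_elim _ n e j (lead_coef Q)).
  + rewrite mulrA -polyCM mulrA En.
    by rewrite sign_reversal // ltnW // ltnW.
  + move=> r r_le; rewrite /block_rows; case: ifP => r_lt.
      apply: leq_trans (size_polyMleq _ _) _.
      rewrite size_polyXn size_polyN.
      move: En sz_mod e_le j_lt q_lt r_lt; clear.
      by move: (size _) (deg P) (deg Q) => x y z; lia.
    apply: leq_trans (size_polyMleq _ _) _.
    by rewrite size_polyXn szQ; lia.
  + move=> r r_gt; rewrite /block_rows ifF; last by lia.
    rewrite lead_coefM lead_coefXn mul1r; split=> //.
    by rewrite mulrC size_mulXn // szQ; lia.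
- by rewrite opprK -divp_eq.
- by rewrite size_divp // szQ szP; lia.
Qed.

(** For j = q - 1 a single row S = - (P mod Q) precedes the rows X^k Q, and all
    of the latter are removed. *)
Lemma sResP_pred P Q : Q != 0 -> (0 < deg Q)%N -> (deg Q < deg P)%N ->
  sResP P Q (deg Q).-1 =
    ((-1) ^+ 'C(deg P - deg Q, 2) * lead_coef Q ^+ (deg P - deg Q).+1)
      *: - (P %% Q).
Proof.
move=> Q0 q_gt0 q_lt.
have szQ : size Q = (deg Q).+1 by rewrite prednK ?size_poly_gt0.
have mod_lt : (size (P %% Q)%R < size Q)%N by rewrite ltn_modp.
rewrite (@sResP_elim _ _ _ 0 (deg P - deg Q).+1) //; try lia.
rewrite rows_det1 /block_rows subn0 ifT; last by lia.
have -> : (deg Q - (deg Q).-1 - 1 - 0 = 0)%N by lia.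
by rewrite expr0 mul1r mul_polyC.
Qed.

(** With S = - (P mod Q), all rows X^k Q of degree larger than that of
    X^(q - j - 1) S are removed; what remains, read from bottom to top, is the
    matrix of (Q, S). *)
Lemma sResP_next P Q j : Q != 0 -> P %% Q != 0 -> (deg Q < deg P)%N ->
  (j <= deg (- (P %% Q))%R)%N ->
  sResP P Q j =
    ((-1) ^+ 'C(deg P - deg Q, 2) * lead_coef Q ^+ (deg P - deg (- (P %% Q))))
      *: sResP Q (- (P %% Q)) j.
Proof.
move=> Q0 S0 q_lt; set S := - _ => j_le.
have szQ : size Q = (deg Q).+1 by rewrite prednK ?size_poly_gt0.
have szS : size S = (deg S).+1 by rewrite prednK // size_polyN size_poly_gt0.
have S_lt : (size S < size Q)%N by rewrite size_polyN ltn_modp.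
have sz_mod : size (P %% Q) = size S by rewrite size_polyN.
rewrite (@sResP_elim _ _ _ (deg Q + deg S - 2 * j).-1 (deg P - deg S)) //; try lia.
rewrite -/S mul_polyC sResP_rows //; last by lia.
rewrite prednK; last by lia.
congr (_ *: _); apply: eq_rows_det => r r_lt; rewrite /block_rows.
have -> : ((deg Q + deg S - 2 * j).-1 - r < deg Q - j)%N = ~~ (r < deg S - j)%N by lia.
by case: ltnP => r_cmp /=; congr ('X^_ * _); lia.
Qed.

End SubresultantStep.

(** * The Cauchy index along the Sturm sequence *)

Section SturmSequence.
Variables (R : rcfType) (P Q : {poly R}).
Hypotheses (P_neq0 : P != 0) (Q_neq0 : Q != 0) (q_lt_p : (deg Q < deg P)%N).
Local Notation S := (sturm P Q).
Local Notation d := (sdeg P Q).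
Local Notation s := (sturm_len P Q).

Lemma sturm_len_end : S s.+1 = 0.
Proof. by rewrite /sturm_len; case: ex_minnP => n /eqP. Qed.

Lemma sturm_neq0 i : (i <= s)%N -> S i != 0.
Proof.
case: i => [_|i]; first exact: P_neq0.
rewrite /sturm_len; case: ex_minnP => n _ n_min lt_in.
by apply/negP => /n_min; rewrite leqNgt lt_in.
Qed.

Lemma sturm_len_gt0 : (0 < s)%N.
Proof.
case E: s => //; have := sturm_len_end; rewrite E sturm1 => /eqP.
by rewrite (negPf Q_neq0).
Qed.

Lemma sdeg_decr i : (i < s)%N -> (d i.+1 < d i)%N.
Proof.
case: i => [//|i] lt_is; rewrite /sdeg /deg.
have Si0 := sturm_neq0 (ltnW lt_is); have SSi0 := sturm_neq0 lt_is.
rewrite -ltnS !prednK ?size_poly_gt0 //.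
by rewrite sturmSS size_polyN ltn_modp.
Qed.

(** The inversion formula is iterated until the remainder vanishes. *)
Lemma Ind_R_sturm :
  Ind_R P Q = \sum_(0 <= i < s | odd (d i - d i.+1))
    Num.sg (lead_coef (S i)) * Num.sg (lead_coef (S i.+1)).
Proof.
have cindex_iter n : cindexR (S 1) (S 0) =
    \sum_(0 <= i < n) crossR (S i * S i.+1) + cindexR (S n.+1) (S n).
  elim: n => [|n IH]; first by rewrite big_nil add0r.
  by rewrite big_nat_recr //= -addrA sturmSS -cindexR_mod.
rewrite Ind_R_cindexR // -[P in cindexR _ P](sturm0 P Q) -[Q in cindexR Q _](sturm1 P Q).
rewrite (cindex_iter s) sturm_len_end cindexR0p addr0 rmorph_sum /= [RHS]big_mkcond /=.
rewrite big_nat [RHS]big_nat; apply: eq_bigr => i lt_is.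
have S1 := sturm_neq0 lt_is; have S0 := sturm_neq0 (ltnW lt_is).
rewrite crossR_mul // oddB ?(ltnW (sdeg_decr lt_is)) // oddD.
by case: (_ (+) _).
Qed.

(** * Signs of the subresultant leading coefficients *)

Local Notation t := (sRest P Q).
Local Notation a i := (Num.sg (lead_coef (S i))).

(** The constant c is the same for all j, so that ratios of consecutive
    subresultants of (P, Q) can be computed from (S_i, S_{i+1}). *)
Lemma sResP_sturm i : (i < s)%N ->
  exists2 c : R, c != 0 &
    forall j, (j <= d i.+1)%N -> sResP P Q j = c *: sResP (S i) (S i.+1) j.
Proof.
elim: i => [_|i IH lt_is].
  by exists 1 => [|j _]; rewrite ?oner_neq0 // scale1r.
have [c c0 Ec] := IH (ltnW lt_is).
have S1 : S i.+1 != 0 := sturm_neq0 (ltnW lt_is).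
have S2 : - (S i %% S i.+1) != 0 by rewrite -sturmSS sturm_neq0.
exists (c * ((-1) ^+ 'C(d i - d i.+1, 2) * lead_coef (S i.+1) ^+ (d i - d i.+2))).
  by rewrite !mulf_neq0 ?signr_eq0 // expf_neq0 ?lead_coef_eq0.
move=> j j_le; rewrite Ec; last exact: leq_trans j_le (ltnW (sdeg_decr lt_is)).
have := @sResP_next _ (S i) (S i.+1) j S1; rewrite -sturmSS => -> //.
- by rewrite scalerA.
- by rewrite -oppr_eq0.
- exact: sdeg_decr (ltnW lt_is).
Qed.

Lemma sResT_sturm i : (i.+1 < s)%N ->
  sResP (S i) (S i.+1) (d i.+1).-1 =
    ((-1) ^+ 'C(d i - d i.+1, 2) * lead_coef (S i.+1) ^+ (d i - d i.+1).+1)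
      *: S i.+2.
Proof.
move=> lt_is; have := @sResP_pred _ (S i) (S i.+1).
rewrite -sturmSS; apply.
- exact: sturm_neq0 (ltnW lt_is).
- exact: leq_ltn_trans (leq0n _) (sdeg_decr lt_is).
- exact: sdeg_decr (ltnW lt_is).
Qed.

(** T_1 = Q: a convention when q < p - 1, and a 1 x 1 determinant when
    q = p - 1. *)
Lemma sResP_top : sResP P Q (deg P).-1 = Q.
Proof.
have [p_le|p_gt] := leqP (deg P).-1 (deg Q); last first.
  by rewrite /sResP leqNgt p_gt /= ifF ?eqxx //; apply/eqP; lia.
have Ep : deg P = (deg Q).+1 by lia.
transitivity (sResP P Q (deg Q)); first by rewrite Ep.
rewrite sResP_rows // subnn.
have -> : (deg P + deg Q - 2 * deg Q = 1)%N by lia.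
by rewrite rows_det1 /block_rows /= expr0 mul1r.
Qed.

Lemma lead_sturm_neq0 i : (i <= s)%N -> lead_coef (S i) != 0.
Proof. by move=> le_is; rewrite lead_coef_eq0 sturm_neq0. Qed.

Lemma sgr_sRest1 : Num.sg (t 1) = a 1.
Proof. by rewrite /sRest /sResT sResP_top. Qed.

(** [sgr_sRest_rec] one step earlier, with 1 in place of the sign of the leading
    coefficient of P. *)
Lemma sgr_sRest2 : (1 < s)%N ->
  Num.sg (t 2) = (-1) ^+ 'C(d 0 - d 1, 2) * a 1 ^+ (d 0 - d 1).+1 * a 2.
Proof.
move=> lt1s; rewrite /sRest /sResT (sResT_sturm lt1s) lead_coefZ !sgrM !sgrX.
by rewrite sgrN sgr1.
Qed.

Lemma sRest_neq0 i : (i <= s)%N -> t i != 0.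
Proof.
case: i => [|[|i]] lt_is; first exact: oner_neq0.
  by rewrite -sgr_eq0 sgr_sRest1 sgr_eq0 lead_sturm_neq0.
have [c c0 Ec] := sResP_sturm (ltnW lt_is).
rewrite /sRest /sResT Ec ?leq_pred // sResT_sturm // scalerA lead_coefZ.
by rewrite !mulf_neq0 ?signr_eq0 ?expf_neq0 ?lead_sturm_neq0 // ltnW.
Qed.

(** Both T_{i+2} and T_{i+3} are computed from the pair (S_i, S_{i+1}): then
    they share the constant of [sResP_sturm] and the sign of the first
    Euclidean step, and the powers of b_{i+1} combine. *)
Lemma sgr_sRest_rec i : (i.+2 < s)%N ->
  Num.sg (t i.+3) = (-1) ^+ 'C(d i.+1 - d i.+2, 2) * a i.+1 ^+ (d i.+1 - d i.+2).+1
    * a i.+2 ^+ (d i.+1 - d i.+2) * a i.+3 * Num.sg (t i.+2).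
Proof.
move=> lt_is; have lt1 := ltnW lt_is; have lt0 := ltnW lt1.
have [c c0 Ec] := sResP_sturm lt0.
have S1 : S i.+1 != 0 := sturm_neq0 lt0.
have E2 : sResT P Q i.+2 =
    (c * ((-1) ^+ 'C(d i - d i.+1, 2) * lead_coef (S i.+1) ^+ (d i - d i.+1).+1))
      *: S i.+2.
  by rewrite /sResT Ec ?leq_pred // sResT_sturm // scalerA.
have E3 : sResT P Q i.+3 =
    (c * ((-1) ^+ 'C(d i - d i.+1, 2) * lead_coef (S i.+1) ^+ (d i - d i.+2))
     * ((-1) ^+ 'C(d i.+1 - d i.+2, 2)
        * lead_coef (S i.+2) ^+ (d i.+1 - d i.+2).+1)) *: S i.+3.
  rewrite -[RHS]scalerA -sResT_sturm // /sResT Ec; last first.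
    exact: leq_trans (leq_pred _) (ltnW (sdeg_decr lt1)).
  have := @sResP_next _ (S i) (S i.+1) (d i.+2).-1 S1.
  rewrite -sturmSS => ->; rewrite ?scalerA ?leq_pred //.
  + by rewrite -oppr_eq0 -sturmSS sturm_neq0 // ltnW.
  + exact: sdeg_decr.
have decr0 := sdeg_decr lt0; have decr1 := sdeg_decr lt1.
rewrite /sRest E2 E3 !lead_coefZ !sgrM !sgrX sgrN sgr1.
have -> : (d i - d i.+2 = (d i - d i.+1) + (d i.+1 - d i.+2))%N by lia.
rewrite exprD !exprS; have := sgr_sqr1 (lead_sturm_neq0 lt0).
move: (a i.+1) (a i.+2) (a i.+3) (Num.sg c) => a1 a2 a3 u a1a1.
move: (_ ^+ 'C(_, 2)) (_ ^+ 'C(d i - _, 2)) (a1 ^+ _) (a1 ^+ _) (a2 ^+ _).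
move=> e e0 x y z; rewrite -[LHS]mul1r -a1a1; ring.
Qed.

(** * The index p(i) *)

Lemma last_oddS i : last_odd P Q i.+1 =
  if odd (d i - d i.+1) then i.+1 else last_odd P Q i.
Proof.
rewrite /last_odd big_mkcond big_ord_recr /= -big_mkcond /=.
case: ifP => _; last by rewrite maxn0.
apply/maxn_idPr/bigmax_leqP => j _; exact: ltnW (ltn_ord j).
Qed.

Lemma last_odd0 : last_odd P Q 0 = 0%N.
Proof. by rewrite /last_odd big_mkcond big_ord_recr big_ord0 /= subSnn. Qed.

Lemma last_odd_le i : (last_odd P Q i <= i)%N.
Proof. by apply/bigmax_leqP => j _; rewrite -ltnS. Qed.

Lemma sdeg_pred_gt i j : (j <= i)%N -> (i <= s)%N -> (d i < sdeg_pred P Q j)%N.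
Proof.
elim: i => [|i IH]; first by rewrite leqn0 => /eqP ->.
rewrite leq_eqVlt => /orP[/eqP -> /sdeg_decr //|]; rewrite ltnS => le_ji lt_is.
exact: ltn_trans (sdeg_decr lt_is) (IH le_ji (ltnW lt_is)).
Qed.

Local Notation gap i := (sdeg_pred P Q (last_odd P Q i) - d i)%N.

(** Induction on i, following the recursion of p(i): [sgr_sRest_rec] gives the
    formula directly if d_{i-1} - d_i is odd, and reduces it to the formula for
    i - 1 otherwise.  At i = 1 the even case starts afresh from t_0 = 1, so the
    sign of the leading coefficient of P matters for i = 0 only. *)
Lemma lead_sturm_sign i : (i < s)%N -> (i == 0%N -> 0 < lead_coef P) ->
  a i = (-1) ^+ 'C(gap i, 2) * Num.sg (t (last_odd P Q i)) * Num.sg (t i.+1)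
        * a i.+1.
Proof.
elim: i => [|[|i] IH] lt_is.
- move=> /(_ isT) P_gt0.
  rewrite last_odd0 /= subSnn /= expr0 sgr1 sgr_sRest1 !mul1r sturm0.
  by rewrite sgr_sqr1 ?lead_sturm_neq0 // gtr0_sg.
- move=> _; rewrite sgr_sRest2 //.
  have := sgr_sqr1 (lead_sturm_neq0 (ltnW lt_is)).
  have := sgr_sqr1 (lead_sturm_neq0 lt_is).
  have := sign_sqr1 R 'C(d 0 - d 1, 2).
  rewrite last_oddS; case: ifP => odd_d.
    rewrite sgr_sRest1 /=.
    move: (a 1) (a 2) ((-1) ^+ _) => a1 a2 e ee a2a2 a1a1.
    rewrite sqr1_exprE //= odd_d /=.
    transitivity ((e * e) * (a2 * a2) * a1); last by ring.
    by rewrite ee a2a2 !mul1r.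
  have decr0 := sdeg_decr (ltnW lt_is).
  rewrite last_odd0 /= sgr1 mulr1.
  (* the convention d_{-1} = p + 1 *)
  have -> : ((deg P).+1 - d 1 = 1 + (d 0 - d 1))%N by rewrite subSn // ltnW.
  rewrite bin2D (@bin_small 1 2) // add0n mul1n exprD.
  rewrite -[X in _ = _ * X * _ * _]signr_odd odd_d mulr1.
  move: (a 1) (a 2) ((-1) ^+ _) => a1 a2 e ee a2a2 a1a1.
  rewrite sqr1_exprE //= odd_d /=.
  transitivity ((e * e) * (a2 * a2) * a1); last by ring.
  by rewrite ee a2a2 !mul1r.
move=> _; have lt1 := ltnW lt_is; have lt0 := ltnW lt1.
have {}IH := IH lt1 ltac:(by []).
have gt_m := sdeg_pred_gt (last_odd_le i.+1) lt0; have decr1 := sdeg_decr lt1.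
have := sgr_sqr1 (lead_sturm_neq0 lt0); have := sgr_sqr1 (lead_sturm_neq0 lt1).
have := sgr_sqr1 (lead_sturm_neq0 lt_is); have := sgr_sqr1 (sRest_neq0 lt1).
have := sgr_sqr1 (sRest_neq0 (leq_trans (last_odd_le i.+1) lt0)).
have := sign_sqr1 R 'C(d i.+1 - d i.+2, 2).
rewrite sgr_sRest_rec // (last_oddS i.+1) /=; case: ifP => odd_d /=.
  move: (a i.+1) (a i.+2) (a i.+3) (Num.sg (t i.+2)) => a1 a2 a3 t2.
  move: ((-1) ^+ _) => e ee _ tt2 aa3 aa2 aa1.
  rewrite !sqr1_exprE //= odd_d /=.
  transitivity ((e * e) * (t2 * t2) * (a3 * a3) * a2); last by ring.
  by rewrite ee tt2 aa3 !mul1r.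
have -> : (sdeg_pred P Q (last_odd P Q i.+1) - d i.+2 =
           gap i.+1 + (d i.+1 - d i.+2))%N by lia.
rewrite bin2D !exprD -[(-1) ^+ (_ * _)]signr_odd oddM odd_d andbF expr0 mulr1.
move: IH; have := sign_sqr1 R 'C(gap i.+1, 2).
move: (a i.+1) (a i.+2) (a i.+3) (Num.sg (t i.+2)) => a1 a2 a3 t2.
move: (Num.sg (t _)) => tm.
move: (_ ^+ 'C(_ - _, 2)) (_ ^+ 'C(gap i.+1, 2)) => e g gg IH ee ttm tt2 aa3 aa2 aa1.
rewrite !sqr1_exprE //= odd_d /= IH.
transitivity ((e * e) * (a3 * a3) * (g * g) * (tm * tm) * (t2 * t2) * a2); last by ring.
by rewrite ee aa3 gg ttm tt2 !mul1r.
Qed.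

Lemma lead_mul_sturm i : (i < s)%N -> (i == 0%N -> 0 < lead_coef P) ->
  a i * a i.+1 =
    eps R ((sdeg_pred P Q (last_odd P Q i))%:Z - (d i)%:Z)
      * Num.sg (t (last_odd P Q i)) * Num.sg (t i.+1).
Proof.
move=> lt_is i0; rewrite {1}(lead_sturm_sign lt_is i0) -[LHS]mulrA.
rewrite sgr_sqr1 ?lead_sturm_neq0 // mulr1.
by rewrite subzn ?eps_nat // ltnW // sdeg_pred_gt ?last_odd_le // ltnW.
Qed.

End SturmSequence.

Unset Implicit Arguments.
Set Strict Implicit.

Theorem theorem19 (R : rcfType) (P Q : {poly R})
    (P_neq0 : P != 0) (Q_neq0 : Q != 0)
    (p_ge1 : (1 <= deg P)%N) (q_lt_p : (deg Q < deg P)%N) :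
  let s := sturm_len P Q in
  let d := sdeg P Q in
  let d_pred := sdeg_pred P Q in
  let t := sRest P Q in
  let pi := last_odd P Q in
  let term i :=
    eps R ((d_pred (pi i))%:Z - (d i)%:Z)
      * Num.sg (t (pi i)) * Num.sg (t i.+1) in
  (0 < lead_coef P \/ ~~ odd (d 0%N - d 1%N) ->
     Ind_R P Q = \sum_(0 <= i < s | odd (d i - d i.+1)) term i)
  /\
  (lead_coef P < 0 /\ odd (d 0%N - d 1%N) ->
     Ind_R P Q = - Num.sg (t 1%N)
       + \sum_(1 <= i < s | odd (d i - d i.+1)) term i).
Proof.
move=> s d d_pred t pi term.
have s_gt0 : (0 < s)%N := sturm_len_gt0 P Q_neq0.
split=> [P_or|[P_lt0 odd0]]; rewrite Ind_R_sturm //.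
  (* i = 0 only occurs when p - q is odd, hence here with P positive at +oo *)
  rewrite big_nat_cond [RHS]big_nat_cond.
  apply: eq_bigr => i /andP[/andP[_ lt_is] odd_i].
  apply: lead_mul_sturm => // /eqP i0; case: P_or => //.
  by rewrite i0 in odd_i; rewrite odd_i.
rewrite big_ltn_cond // odd0; congr (_ + _).
  by rewrite sturm0 (ltr0_sg P_lt0) mulN1r /t sgr_sRest1.
rewrite big_nat_cond [RHS]big_nat_cond.
apply: eq_bigr => i /andP[/andP[i_gt0 lt_is] _].
by apply: lead_mul_sturm => // /eqP i0; rewrite i0 in i_gt0.
Qed.
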